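(* Let $n\ge 2$ and consider a graphical time-like translator $\Gamma:\Omega\to\mathbb{H}^n\times_{-1}\mathbb{R}$, $\Gamma(p)=(p,u(p))$ for all $p\in\Omega$, where $\Omega\subset\mathbb{H}^n$ is open and connected and $u\in C^2(\Omega)$. Then $\Gamma$ is foliated by horospheres if, and only if, there exists $f\in C^2(I)$, $I\subseteq\mathbb{R}$ an interval with $\Omega=\rho^{-1}(I)$, such that $u=f\circ\rho$ and $f$ is one of the following: (1) $n=2$, $f_2:(-\infty,s_0)\to\mathbb{R}$, $f_2(s)=\int P_1^{-1}(s)\,ds+f_0$, $f_0\in\mathbb{R}$; (2) $n=2$, $f_4:(-\infty,s_0)\to\mathbb{R}$, $f_4(s)=\int P_3^{-1}(s)\,ds+f_0$, $f_0\in\mathbb{R}$; (3) $n>2$, $f_5:\left(-\infty,\frac{1-n}{n^2-2n}\ln(n-1)\right)\to\mathbb{R}$, $f_5(s)=\int Q_1^{-1}(s)\,ds+f_0$, $f_0\in\mathbb{R}$; (4) $n>2$, $f_8:\left(-\infty,\frac{n-1}{2n-n^2}\ln(n-1)\right)\to\mathbb{R}$, $f_8(s)=\int Q_4^{-1}(s)\,ds+f_0$, $f_0\in\mathbb{R}$.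
   Context: $\mathbb{H}^n=\{(x_1,\dots,x_n)\in\mathbb{R}^n : x_1>0\}$ is hyperbolic space with metric $g_{\mathbb{H}^n}=x_1^{-2}\langle\cdot,\cdot\rangle$, $\langle\cdot,\cdot\rangle$ Euclidean. $\mathbb{H}^n\times_{-1}\mathbb{R}$ is $\mathbb{H}^n\times\mathbb{R}$ with the Lorentzian metric $g_{\mathbb{H}^n}-dt^2$. For $u\in C^2(\Omega)$, let $\nabla u$, $|\nabla u|$, $\mathrm{div}$ be taken with respect to $g_{\mathbb{H}^n}$. The graph map $\Gamma(p)=(p,u(p))$ is assumed non-degenerate, with $\varepsilon=\mathrm{sign}(|\nabla u|^2-1)=\pm1$ constant on $\Omega$; it is time-like if $|\nabla u|>1$ ($\varepsilon=+1$). $\Gamma$ is a (graphical) translator if its mean curvature vector equals $\partial_t^\perp$, the normal projection of $\partial_t$; equivalently $$\mathrm{div}\left(\frac{\nabla u}{\sqrt{\varepsilon(|\nabla u|^2-1)}}\right)=\frac{1}{\sqrt{\varepsilon(|\nabla u|^2-1)}}.$$ Horospheres here are the sets $\{x_1=\text{const}\}$, i.e. the level sets of the projection $\rho:\mathbb{H}^n\to\mathbb{R}$, $\rho(x_1,\dots,x_n)=\ln x_1$. $\Gamma$ is foliated by horospheres if $\Omega$ is foliated by such level sets and $u$ is constant on each of them (i.e. $u$ depends only on $x_1$). Put $\mathbf{P}(x)=-\tfrac14\ln|1-x|+\tfrac12\cdot\tfrac{1}{1-x}+\tfrac14\ln|1+x|$. $P_1=\mathbf{P}|_{(-\infty,-1)}$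 is a decreasing bijection onto $(-\infty,0)$, and $P_3=\mathbf{P}|_{(1,+\infty)}$ is an increasing bijection onto $(-\infty,0)$. The number $s_0\in\mathbb{R}$ in items (1) and (2) is the constant of integration in the relation $\mathbf{P}(f'(s))=s-s_0$ from which these functions arise. For $m=n-1>1$ put $\mathbf{Q}(x)=\tfrac{1}{2m-2}\ln|1-x|+\tfrac{1}{2m+2}\ln|1+x|-\tfrac{m}{m^2-1}\ln|1-mx|$. $Q_1=\mathbf{Q}|_{(-\infty,-1)}$ is a decreasing bijection and $Q_4=\mathbf{Q}|_{(1,+\infty)}$ is an increasing bijection, both onto $\left(-\infty,\frac{m}{1-m^2}\ln m\right)$.
   Formalization: ρ is taken as −ln x_1 instead of ln x_1 (with ln x_1 the listed functions do not solve the translator equation), and items (3), (4) get an integration constant s_0 as in (1), (2), shifting the argument of Q_i^{-1} and the interval by s_0. *)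

(* Defs.v *)
From HB Require Import structures.
From mathcomp Require Import all_boot all_order all_algebra.
From mathcomp Require Import all_classical all_reals all_analysis.

Set Implicit Arguments.
Unset Strict Implicit.
Unset Printing Implicit Defensive.

Import Order.TTheory GRing.Theory Num.Theory.
Import numFieldNormedType.Exports.

Local Open Scope classical_set_scope.
Local Open Scope ring_scope.

(* Semi-Riemannian geometry in one global chart: a metric is a map sending a
   point of R^N to a symmetric invertible matrix. *)

Definition partial (R : realType) (n : nat) (i : 'I_n) (f : 'rV[R]_n -> R)
    (p : 'rV[R]_n) : R :=
  'D_(delta_mx 0 i) f p.

(* A function on an open set D is represented by a total function; its values
   outside D play no role. *)
Definition C2_on (R : realType) (n : nat) (D : set 'rV[R]_n)
    (f : 'rV[R]_n -> R) : Prop :=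
  forall p, D p ->
    {for p, continuous f} /\
    forall i : 'I_n,
      [/\ derivable f p (delta_mx 0 i),
          {for p, continuous (partial i f)} &
          forall j : 'I_n,
            derivable (partial i f) p (delta_mx 0 j) /\
            {for p, continuous (partial j (partial i f))}].

Definition C2_on_line (R : realType) (I : set R) (f : R -> R) : Prop :=
  forall s, I s ->
    [/\ {for s, continuous f},
        derivable f s 1, {for s, continuous (derive1 f)},
        derivable (derive1 f) s 1 & {for s, continuous (derive1n 2 f)}].

Definition metric (R : realType) (n : nat) := 'rV[R]_n -> 'M[R]_n.

Definition inner (R : realType) (n : nat) (g : metric R n)
    (p v w : 'rV[R]_n) : R :=
  (v *m g p *m w^T) 0 0.

Definition riem_norm (R : realType) (n : nat) (g : metric R n)
    (p v : 'rV[R]_n) : R :=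
  Num.sqrt (inner g p v v).

Definition gradient (R : realType) (n : nat) (g : metric R n)
    (u : 'rV[R]_n -> R) (p : 'rV[R]_n) : 'rV[R]_n :=
  \row_i \sum_(j < n) invmx (g p) i j * partial j u p.

(* Christoffel symbol Gamma^k_{ij} of the Levi-Civita connection. *)
Definition christoffel (R : realType) (n : nat) (g : metric R n)
    (p : 'rV[R]_n) (k i j : 'I_n) : R :=
  2^-1 * \sum_(l < n) invmx (g p) k l *
    (partial i (fun x => g x j l) p + partial j (fun x => g x i l) p
     - partial l (fun x => g x i j) p).

Section Immersion.
Variables (R : realType) (n N : nat) (G : metric R N).
Variable F : 'rV[R]_n -> 'rV[R]_N.

Definition tangent (i : 'I_n) (p : 'rV[R]_n) : 'rV[R]_N :=
  \row_a partial i (fun x => F x 0 a) p.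

Definition induced_metric : metric R n :=
  fun p => \matrix_(i, j) inner G (F p) (tangent i p) (tangent j p).

(* Meaningful where the immersion is non-degenerate, i.e. where the induced
   metric is invertible. *)
Definition normal_part (p : 'rV[R]_n) (v : 'rV[R]_N) : 'rV[R]_N :=
  v - \sum_(i < n) \sum_(j < n)
        (invmx (induced_metric p) i j * inner G (F p) v (tangent j p))
          *: tangent i p.

(* Ambient covariant derivative of F_*(d_j) in the direction F_*(d_i). *)
Definition cov_deriv (i j : 'I_n) (p : 'rV[R]_n) : 'rV[R]_N :=
  \row_a (partial i (fun x => tangent j x 0 a) p
          + \sum_(b < N) \sum_(c < N) christoffel G (F p) a b c
              * tangent i p 0 b * tangent j p 0 c).

Definition second_fundamental_form (i j : 'I_n) (p : 'rV[R]_n) : 'rV[R]_N :=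
  normal_part p (cov_deriv i j p).

(* Trace of the second fundamental form, without the factor 1/n. *)
Definition mean_curvature_vector (p : 'rV[R]_n) : 'rV[R]_N :=
  \sum_(i < n) \sum_(j < n)
    invmx (induced_metric p) i j *: second_fundamental_form i j p.

End Immersion.

(* Hyperbolic space of dimension n = m.+1; the coordinate x_1 is [x 0 0]. *)

Definition half_space (R : realType) (m : nat) : set 'rV[R]_m.+1 :=
  [set x | 0 < x 0 0].

Definition hyperbolic_metric (R : realType) (m : nat) : metric R m.+1 :=
  fun x => (x 0 0 ^- 2)%:M.

(* Coordinates on H^n x R: the first m.+1 ones are those of H^n, the last one
   is t. *)
Definition lorentz_product_metric (R : realType) (m : nat) :
    metric R (m.+1 + 1) :=
  fun q => block_mx (hyperbolic_metric (lsubmx q)) 0 0 (- 1%:M).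

Definition graph_map (R : realType) (m : nat) (u : 'rV[R]_m.+1 -> R)
    (p : 'rV[R]_m.+1) : 'rV[R]_(m.+1 + 1) :=
  row_mx p (u p)%:M.

Definition partial_t (R : realType) (m : nat) : 'rV[R]_(m.+1 + 1) :=
  row_mx 0 1%:M.

Definition time_like_graph (R : realType) (m : nat) (Omega : set 'rV[R]_m.+1)
    (u : 'rV[R]_m.+1 -> R) : Prop :=
  forall p, Omega p ->
    1 < riem_norm (@hyperbolic_metric R m) p
          (gradient (@hyperbolic_metric R m) u p).

Definition graphical_translator (R : realType) (m : nat)
    (Omega : set 'rV[R]_m.+1) (u : 'rV[R]_m.+1 -> R) : Prop :=
  forall p, Omega p ->
    mean_curvature_vector (@lorentz_product_metric R m) (graph_map u) p
    = normal_part (@lorentz_product_metric R m) (graph_map u) p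
        (partial_t R m).

Definition horosphere (R : realType) (m : nat) (c : R) : set 'rV[R]_m.+1 :=
  [set x | half_space x /\ x 0 0 = c].

Definition foliated_by_horospheres (R : realType) (m : nat)
    (Omega : set 'rV[R]_m.+1) (u : 'rV[R]_m.+1 -> R) : Prop :=
  (forall p, Omega p -> @horosphere R m (p 0 0) `<=` Omega) /\
  (forall c p q, (Omega `&` @horosphere R m c) p ->
     (Omega `&` @horosphere R m c) q -> u p = u q).

(* The sign is the one for which div (grad rho) = n - 1: for u = f o rho the
   translator equation is then f'' = (1 - (n - 1) f') (1 - f' ^ 2), which is
   the equation integrated by P (n = 2) and Q (n > 2) below.  For ln x_1
   instead, div (grad (ln x_1)) = 1 - n and the factor 1 - (n - 1) f' becomes
   1 + (n - 1) f', which P and Q do not integrate. *)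
Definition rho (R : realType) (m : nat) (x : 'rV[R]_m.+1) : R := - ln (x 0 0).

Section Profiles.
Variable R : realType.

Definition P (x : R) : R :=
  - 4^-1 * ln `|1 - x| + 2^-1 * (1 - x)^-1 + 4^-1 * ln `|1 + x|.

Definition Q (m : nat) (x : R) : R :=
  (2 * m%:R - 2)^-1 * ln `|1 - x| + (2 * m%:R + 2)^-1 * ln `|1 + x|
  - m%:R / (m%:R ^+ 2 - 1) * ln `|1 - m%:R * x|.

(* Inverses of the restrictions of P and Q to the given intervals; the value 0
   outside the ranges of these restrictions is never used. *)
Definition P1_inv : R -> R := 'pinv_(fun=> 0) `]-oo, (-1)[ P.
Definition P3_inv : R -> R := 'pinv_(fun=> 0) `]1, +oo[ P.
Definition Q1_inv (m : nat) : R -> R := 'pinv_(fun=> 0) `]-oo, (-1)[ (Q m).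
Definition Q4_inv (m : nat) : R -> R := 'pinv_(fun=> 0) `]1, +oo[ (Q m).

Definition primitive_on (D : set R) (h F : R -> R) : Prop :=
  forall s, D s -> is_derive s 1 F (h s).

(* f is, on I, the function  s |-> \int h(s - s0) ds + f0  defined on
   ]-oo, s0 + b[, where ]-oo, b[ is the domain of h. *)
Definition profile (h : R -> R) (b : R) (I : set R) (f : R -> R) : Prop :=
  exists s0 f0 : R, exists F : R -> R,
    [/\ primitive_on `]-oo, s0 + b[ (fun s => h (s - s0)) F,
        I `<=` `]-oo, s0 + b[ &
        forall s, I s -> f s = F s + f0].

Definition translator_profile (n : nat) (I : set R) (f : R -> R) : Prop :=
  [\/ n = 2%N /\ profile P1_inv 0 I f,
      n = 2%N /\ profile P3_inv 0 I f,
      (2 < n)%N /\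
        profile (Q1_inv n.-1)
          ((1 - n%:R) / (n%:R ^+ 2 - 2 * n%:R) * ln (n%:R - 1)) I f |
      (2 < n)%N /\
        profile (Q4_inv n.-1)
          ((n%:R - 1) / (2 * n%:R - n%:R ^+ 2) * ln (n%:R - 1)) I f].

End Profiles.

(* Main.v *)
(* Write [u = f o rho] on a saturated [Omega].  Pairing the translator equation
   with the conormal [a dx_1 - dt], [a = d_1 u], which kills every tangent vector
   of the graph, reduces it to [f'' = (1 - m f') (1 - f'^2)], [m = n - 1].
   Since [P] (for [m = 1]) and [Q] are primitives of
   [w x = 1 / ((1 - m x) (1 - x^2))], the function [P (f' s) - s] is constant on
   [I], and [|f'| > 1] confines [f'] to one of the two outer branches.  A
   primitive of the inverse function needs no integral: if [G' x = x w x], then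
   [G] composed with the inverse of [P] has derivative the inverse of [P]. *)

Require Import Defs.
From HB Require Import structures.
From mathcomp Require Import all_boot all_order all_algebra.
From mathcomp Require Import all_classical all_reals all_analysis.
From mathcomp Require Import ring lra.

Import Order.TTheory GRing.Theory Num.Theory.
Import numFieldNormedType.Exports.

Local Open Scope classical_set_scope.
Local Open Scope ring_scope.

(** * One-variable calculus and integration of a separable equation *)

Lemma is_derive_ln_norm (R : realType) (g : R -> R) (x dg : R) :
  g x != 0 -> is_derive x 1 g dg ->
  is_derive x 1 (fun z => ln `|g z|) (dg / g x).
Proof.
move=> gx0 dgx.
have hln : is_derive (g x) 1 (fun z => ln `|z|) (g x)^-1.
  have [gneg|gpos|/eqP] := ltgtP (g x) 0; last by rewrite (negbTE gx0).
  - have e : \forall z \near g x, (@ln R \o -%R) z = ln `|z|.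
      by near=> z; rewrite /= ltr0_norm//; near: z; exact: lt_nbhsl.
    apply: (@near_eq_is_derive _ _ _ (@ln R \o -%R)) => //.
    rewrite -[(g x)^-1]opprK -mulrN1 -invrN; apply: is_derive1_comp.
    by apply: is_derive1_ln; rewrite oppr_gt0.
  - have e : \forall z \near g x, ln z = ln `|z|.
      by near=> z; rewrite gtr0_norm//; near: z; exact: lt_nbhsr.
    by apply: (@near_eq_is_derive _ _ _ (@ln R)) => //; exact: is_derive1_ln.
rewrite mulrC; exact: (is_derive1_comp hln dgx).
Unshelve. all: by end_near. Qed.

Lemma zero_derivative_constant (R : realType) (I : set R) (f : R -> R) :
  is_interval I -> (forall s, I s -> is_derive s 1 f 0) ->
  forall s t, I s -> I t -> f s = f t.
Proof.
move=> hI hf s t; wlog st : s t / s <= t.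
  by move=> H Is It; case: (leP s t) => [/H ->//|/ltW/H ->].
move=> Is It.
have sub x : x \in `[s, t]%R -> I x by rewrite in_itv /= => /hI; exact.
have [x||c _] := @MVT_segment R f (cst 0) s t st.
- by move=> /subset_itv_oo_cc/sub/hf.
- apply: derivable_within_continuous => x /sub/hf []; exact.
- by rewrite mul0r => /eqP; rewrite subr_eq0 => /eqP.
Qed.

(** Treats the four branches at once: [K] is the branch, [W] is [P] or [Q], and [w] is its
    derivative, the reciprocal of the right-hand side of the profile equation. The hypothesis
    [w (f1 s) * f2 s = 1] is separation of variables: it makes [W (f1 s) - s] constant. *)
Lemma profile_of_relation (R : realType) (K I : set R) (W G w f f1 f2 : R -> R)
    (b : R) :
  open K -> set_inj K W -> W @` K = `]-oo, b[%classic ->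
  (forall x, K x -> w x != 0) ->
  (forall x, K x -> is_derive x 1 W (w x)) ->
  (forall x, K x -> is_derive x 1 G (x * w x)) ->
  is_interval I ->
  (forall s, I s -> K (f1 s)) ->
  (forall s, I s -> is_derive s 1 f (f1 s)) ->
  (forall s, I s -> is_derive s 1 f1 (f2 s)) ->
  (forall s, I s -> w (f1 s) * f2 s = 1) ->
  profile ('pinv_(fun=> 0) K W) b I f.
Proof.
move=> oK injW imW w0 dW dG itvI KI df df1 ode.
set h := 'pinv_(fun=> 0) K W.
have hK x : K x -> h (W x) = x.
  by move=> Kx; apply: pinvKV => //; rewrite inE.
have memW x : K x -> W x < b.
  move=> Kx; have : (W @` K) (W x) by exists x.
  by rewrite imW /= in_itv.
have prim s0 : primitive_on `]-oo, s0 + b[ (fun s => h (s - s0))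
    (fun s => G (h (s - s0))).
  move=> s /=; rewrite in_itv /= => sb.
  have : (W @` K) (s - s0) by rewrite imW /= in_itv /=; lra.
  move=> [x Kx Wx]; rewrite -Wx hK //.
  have nK : \forall y \near x, K y by apply: open_nbhs_nbhs.
  have dh : is_derive (W x) 1 h (w x)^-1.
    apply: is_derive_inverse; last exact: w0.
    - by near=> y; apply: hK; near: y.
    - near=> y; apply/differentiable_continuous/derivable1_diffP.
      by have /dW [] : K y by near: y.
    - exact: dW.
  rewrite Wx in dh.
  have dsh : is_derive s 1 (fun s : R => s - s0) 1.
    by apply: (is_derive_eq (is_deriveB _ _)); rewrite subr0.
  have dhs := is_derive1_comp (dh : is_derive ((fun s : R => s - s0) s) 1 h _) dsh.
  have Gx : is_derive ((h \o (fun s : R => s - s0)) s) 1 G (x * w x).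
    by rewrite /= -Wx hK //; exact: dG.
  apply: (is_derive_eq (is_derive1_comp Gx dhs)).
  by rewrite mulr1 mulfK // w0.
(* The constants are read off at a point of [I]; for empty [I] the conditions on [I] are vacuous and
   [0, 0] serve. *)
have [[s1 Is1]|I0] := pselect (exists s, I s); last first.
  exists 0, 0, (fun s => G (h (s - 0))); split; first exact: prim.
  - by move=> s Is; exfalso; apply: I0; exists s.
  - by move=> s Is; exfalso; apply: I0; exists s.
pose s0 := s1 - W (f1 s1).
have relation s : I s -> W (f1 s) = s - s0.
  move=> Is.
  have := @zero_derivative_constant R I (fun s => W (f1 s) - s) itvI _ s s1 Is Is1.
  move=> H; rewrite /s0; suff : W (f1 s) - s = W (f1 s1) - s1 by lra.
  apply: H => t It.
  apply: (is_derive_eq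
    (is_deriveB (is_derive1_comp (dW _ (KI _ It)) (df1 _ It)) _)).
  by rewrite ode // subrr.
(* The function [f - G \o f1] has derivative [f1 - f1 * w f1 * f2 = 0], so its value at [s1] is the
   additive constant. *)
exists s0, (f s1 - G (f1 s1)), (fun s => G (h (s - s0))); split.
- exact: prim.
- move=> s Is /=; rewrite in_itv /=.
  by have := memW _ (KI _ Is); rewrite relation //; lra.
- move=> s Is; rewrite -relation // hK; last exact: KI.
  suff : f s - G (f1 s) = f s1 - G (f1 s1) by lra.
  apply: (@zero_derivative_constant R I (fun s => f s - G (f1 s)) itvI) => // t It.
  apply: (is_derive_eq (is_deriveB (df _ It)
    (is_derive1_comp (dG _ (KI _ It)) (df1 _ It)))).
  by rewrite -mulrA ode // mulr1 subrr.
Unshelve. all: by end_near. Qed.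

(** * Injectivity and ranges of [P] and [Q] on their outer branches *)

(** The mean value theorem makes [V] strictly decreasing on [[0, 1)]. Since [V] also goes below any
    bound, the intermediate value theorem yields every [v < V 0]; the value [V 0] itself is missed
    because [0] is excluded. *)
Lemma decreasing_image (R : realType) (V dV : R -> R) :
  (forall y : R, 0 <= y < 1 -> is_derive y 1 V (dV y)) ->
  (forall y : R, 0 < y < 1 -> dV y < 0) ->
  (forall M, exists2 y : R, 0 < y < 1 & V y <= M) ->
  {in [set y : R | 0 < y < 1] &, injective V} /\
  V @` [set y | 0 < y < 1] = [set v | v < V 0].
Proof.
move=> hdV dVn unb.
have cV a b : 0 <= a -> b < 1 -> {within `[a, b], continuous V}.
  move=> a0 b1; apply: derivable_within_continuous => x.
  by rewrite in_itv /= => xab; have [] := hdV x ltac:(lra).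
have decr a b : 0 <= a -> a < b -> b < 1 -> V b < V a.
  move=> a0 ab b1.
  have [x xab||c] := @MVT R V dV a b ab.
  - by apply: hdV; move: xab; rewrite in_itv /=; lra.
  - exact: cV.
  - rewrite in_itv /= => cab e; rewrite -subr_lt0 e pmulr_llt0 ?subr_gt0 //.
    by apply: dVn; lra.
split.
  move=> x y; rewrite !inE /= => hx hy e.
  have [xy|yx|//] := ltgtP x y.
  - by have := decr x y ltac:(lra) xy ltac:(lra); lra.
  - by have := decr y x ltac:(lra) yx ltac:(lra); lra.
apply/seteqP; split => [_ [x hx <-]|v hv] /=.
  by move: hx => /= ?; apply: decr; lra.
have [y y01 yv] := unb v.
rewrite /= in hv; have Vy : V y < V 0 by exact: le_lt_trans yv hv.
have [||c] := @IVT R V 0 y v ltac:(lra).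
- by apply: cV; lra.
- by rewrite min_r ?max_l; lra.
- rewrite in_itv /= => hc Vc; exists c => //=.
  have : c != 0 by apply/eqP => c0; move: hv; rewrite -Vc c0; lra.
  by move=> c0; rewrite lt_neqAle eq_sym c0 /=; lra.
Qed.

(* The substitution [y = 1 / x] turns both branches at infinity of [W] into the
   two sides of a strict maximum of [V] at [0]. *)
Lemma outer_branches (R : realType) (W V dV : R -> R) :
  (forall x : R, 1 < `|x| -> W x = V x^-1) ->
  (forall y : R, `|y| < 1 -> is_derive y 1 V (dV y)) ->
  (forall y : R, `|y| < 1 -> y != 0 -> y * dV y < 0) ->
  (forall M, exists2 y : R, 0 < y < 1 & V y <= M) ->
  (forall M, exists2 y : R, 0 < y < 1 & V (- y) <= M) ->
  (set_inj (`]-oo, (-1)[ : set R) W /\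
    @image R R `]-oo, (-1)[ W = `]-oo, V 0[%classic) /\
  (set_inj (`]1, +oo[ : set R) W /\
    @image R R `]1, +oo[ W = `]-oo, V 0[%classic).
Proof.
move=> hW hdV sgn unbp unbn.
have itvV (x : R) : 1 < x -> 0 < x^-1 < 1.
  by move=> x1; rewrite invr_gt0 invf_lt1; lra.
have [injp imp] : {in [set y : R | 0 < y < 1] &, injective V} /\
    V @` [set y | 0 < y < 1] = [set v | v < V 0].
  apply: (@decreasing_image R V dV) => // y hy.
  - by apply: hdV; rewrite ger0_norm; lra.
  - have : y * dV y < 0 by apply: sgn; [rewrite ger0_norm; lra|apply/eqP; lra].
    by rewrite pmulr_rlt0; lra.
(* The branch at minus infinity corresponds to [y < 0]; the reflection [- y] brings it to
   [(0, 1)]. *)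
have [injn imn] : {in [set y : R | 0 < y < 1] &, injective (V \o -%R)} /\
    (V \o -%R) @` [set y | 0 < y < 1] = [set v | v < V 0].
  rewrite -[in V 0]oppr0; apply: (@decreasing_image R _ (fun y => - dV (- y))).
  - move=> y hy; rewrite -mulrN1; apply: is_derive1_comp.
    by apply: hdV; rewrite normrN ger0_norm; lra.
  - move=> y hy.
    have : (- y) * dV (- y) < 0.
      by apply: sgn; [rewrite normrN ger0_norm; lra|apply/eqP; lra].
    by rewrite mulNr -mulrN pmulr_rlt0; lra.
  - exact: unbn.
split; split.
- move=> x y; rewrite !inE /= !in_itv /= => hx hy.
  have ix := itvV (- x) ltac:(lra); have iy := itvV (- y) ltac:(lra).
  rewrite !hW ?ltr0_norm; try lra.
  move=> e; have := @injn (- x^-1) (- y^-1); rewrite !inE /= !opprK -!invrN.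
  by move=> /(_ ix iy e)/invr_inj/oppr_inj.
- apply/seteqP; split => [_ [x /= + <-]|v /=]; rewrite in_itv /= => hx.
  + have ix := itvV (- x) ltac:(lra).
    suff : [set v | v < V 0] (W x) by rewrite in_itv.
    rewrite -imn; exists (- x^-1); first by rewrite /= -invrN.
    by rewrite /= opprK hW // ltr0_norm; lra.
  + have : [set v | v < V 0] v by [].
    rewrite -imn => -[y /= hy <-].
    have ? : 1 < y^-1 by rewrite invf_gt1; lra.
    exists (- y^-1); first by rewrite /= in_itv /=; lra.
    by rewrite hW ?invrN ?invrK // normrN ger0_norm; lra.
- move=> x y; rewrite !inE /= !in_itv /= !andbT => hx hy.
  rewrite !hW ?gtr0_norm; try lra.
  move=> e; have := @injp x^-1 y^-1; rewrite !inE /=.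
  by move=> /(_ (itvV x hx) (itvV y hy) e)/invr_inj.
- apply/seteqP; split => [_ [x /= + <-]|v /=]; rewrite in_itv /= ?andbT => hx.
  + suff : [set v | v < V 0] (W x) by rewrite in_itv.
    rewrite -imp; exists x^-1; first exact: itvV.
    by rewrite hW // gtr0_norm; lra.
  + have : [set v | v < V 0] v by [].
    rewrite -imp => -[y /= hy <-].
    have ? : 1 < y^-1 by rewrite invf_gt1; lra.
    exists y^-1; first by rewrite /= in_itv /= andbT.
    by rewrite hW ?invrK // ger0_norm; lra.
Qed.

Lemma ln_norm_div (R : realType) (p q : R) :
  p != 0 -> q != 0 -> ln `|p / q| = ln `|p| - ln `|q|.
Proof. by move=> p0 q0; rewrite normrM normfV ln_div // posrE normr_gt0. Qed.

(** Supplies points where [P] and [Q], in the variable [y = 1 / x], lie below a given bound. The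
    second estimate, [expR t >= 1 + t], lets the pole [(1 - y)^-1] in [P] dominate the logarithm,
    which has the opposite sign there. *)
Lemma ln_near_one (R : realType) (t : R) : 0 < t ->
  exists2 y : R, 0 < y < 1 & ln (1 - y) = - t /\ 1 + t <= (1 - y)^-1.
Proof.
move=> t0; exists (1 - expR (- t)).
  have := expR_gt0 (- t); have : expR (- t) < 1 by rewrite expR_lt1; lra.
  lra.
by rewrite opprB addrC subrK expRK expRN invrK; split=> //; exact: expR_ge1Dx.
Qed.

(** For [V y = P (1 / y)] the two terms in [ln |y|] cancel, so [V] is regular at [y = 0], and
    [V 0 = 0] is the limit of [P] at both infinities. *)
Lemma P_branches (R : realType) :
  (set_inj (`]-oo, (-1)[ : set R) (@P R) /\
    @image R R `]-oo, (-1)[ (@P R) = `]-oo, 0[%classic) /\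
  (set_inj (`]1, +oo[ : set R) (@P R) /\
    @image R R `]1, +oo[ (@P R) = `]-oo, 0[%classic).
Proof.
pose V y : R :=
  4^-1 * ln `|1 + y| - 4^-1 * ln `|1 - y| + (2^-1 - 2^-1 * (1 - y)^-1).
pose dV y : R :=
  4^-1 * (1 / (1 + y)) - 4^-1 * (- 1 / (1 - y)) - 2^-1 * (1 - y) ^- 2.
have V0 : V 0 = 0 by rewrite /V addr0 subr0 normr1 ln1 invr1; lra.
have := @outer_branches R (@P R) V dV; rewrite V0; apply.
- move=> x x1.
  have x0 : x != 0 by apply/eqP => e; move: x1; rewrite e normr0; lra.
  have xp : 1 + x != 0.
    by apply/eqP => e; move: x1; rewrite (_ : x = -1) ?normrN ?normr1; lra.
  have xm : 1 - x != 0.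
    by apply/eqP => e; move: x1; rewrite (_ : x = 1) ?normrN ?normr1; lra.
  have xm' : x - 1 != 0 by rewrite -opprB oppr_eq0.
  have -> : V x^-1 = 4^-1 * ln `|(1 + x) / x| - 4^-1 * ln `|(1 - x) / x| +
      (2^-1 - 2^-1 * (1 - x^-1)^-1).
    rewrite /V; congr (_ * ln _ - _ * ln _ + _).
      by congr `|_|; field.
    by rewrite -normrN; congr `|_|; field.
  rewrite !ln_norm_div // /P.
  have -> : 2^-1 - 2^-1 * (1 - x^-1)^-1 = 2^-1 * (1 - x)^-1.
    by field; rewrite xm xm' x0.
  by ring.
- move=> y; rewrite ltr_norml => hy.
  have yp : 1 + y != 0 by apply/eqP; lra.
  have ym : 1 - y != 0 by apply/eqP; lra.
  have dp : is_derive y 1 (fun z : R => 1 + z) 1.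
    by apply: (is_derive_eq (is_deriveD _ _)); rewrite add0r.
  have dm : is_derive y 1 (fun z : R => 1 - z) (- 1).
    by apply: (is_derive_eq (is_deriveB _ _)); rewrite sub0r.
  have D := is_deriveD (is_deriveB
    (is_deriveZ 4^-1 (is_derive_ln_norm R (fun z => 1 + z) y _ yp dp))
    (is_deriveZ 4^-1 (is_derive_ln_norm R (fun z => 1 - z) y _ ym dm)))
    (is_deriveB (is_derive_cst (2^-1 : R) _ _)
    (is_deriveZ 2^-1 (is_deriveV (f := fun z : R => 1 - z) ym dm))).
  apply: (@is_derive_eq _ _ _ V y 1 _ _ D).
  by rewrite /dV /GRing.scale /=; ring.
- move=> y; rewrite ltr_norml => hy y0.
  have yp : 1 + y != 0 by apply/eqP; lra.
  have ym : 1 - y != 0 by apply/eqP; lra.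
  (* By the chain rule this is [- w (1 / y) / y] with [w] the derivative of [P], so the partial
     fractions recombine into one term of constant sign. *)
  have -> : y * dV y = - (y ^+ 2 / ((1 - y) ^+ 2 * (1 + y))).
    by rewrite /dV; field; rewrite yp ym.
  rewrite oppr_lt0 divr_gt0 ?exprn_even_gt0 // mulr_gt0 ?exprn_even_gt0 //.
  by lra.
- move=> M; have M0 := normr_ge0 M.
  (* With [ln (1 - y) = - t], the bounds [ln (1 + y) <= y < 1] and [(1 - y)^-1 >= 1 + t] give
     [V y <= (1 - t) / 4], which is [- |M|] for this [t]. *)
  have [y y01 [ly iy]] := @ln_near_one R (1 + 4 * `|M|) ltac:(lra).
  exists y => //; rewrite /V !ger0_norm; try lra.
  have := @le_ln1Dx R y ltac:(lra).
  have := ler_norm (- M); rewrite normrN ly; lra.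
- move=> M; have M0 := normr_ge0 M.
  (* Here the logarithm alone diverges: [V (- y) <= (2 - t) / 4], again [- |M|]. *)
  have [y y01 [ly iy]] := @ln_near_one R (2 + 4 * `|M|) ltac:(lra).
  exists y => //; rewrite /V opprK !ger0_norm; try lra.
  have : 0 <= ln (1 + y) by apply: ln_ge0; lra.
  have : 0 < (1 + y)^-1 by rewrite invr_gt0; lra.
  have := ler_norm (- M); rewrite normrN ly; lra.
Qed.

(** The value at [0] of [V y = Q m (1 / y)] is the limit of [Q m] at both infinities, which is [b].
    Near [y = 1] and [y = -1] the terms with coefficients [A] and [B] respectively diverge, while
    [c >= 2] keeps [c - y] above [1]. *)
Lemma Q_branches (R : realType) (m : nat) (b : R) :
  (1 < m)%N -> b = - (m%:R / (m%:R ^+ 2 - 1) * ln m%:R) ->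
  (set_inj (`]-oo, (-1)[ : set R) (@Q R m) /\
    @image R R `]-oo, (-1)[ (@Q R m) = `]-oo, b[%classic) /\
  (set_inj (`]1, +oo[ : set R) (@Q R m) /\
    @image R R `]1, +oo[ (@Q R m) = `]-oo, b[%classic).
Proof.
move=> m1 ->; set c : R := m%:R.
have c2 : 2 <= c by rewrite ler_nat.
set A := (2 * c - 2)^-1; set B := (2 * c + 2)^-1; set C := c / (c ^+ 2 - 1).
have A0 : 0 < A by rewrite invr_gt0; lra.
have A1 : A <= 1 by rewrite invf_le1; lra.
have B0 : 0 < B by rewrite invr_gt0; lra.
have B1 : B <= 1 by rewrite invf_le1; lra.
have C0 : 0 < C by rewrite divr_gt0 //; nra.
have nz1 : c + 1 != 0 by apply/eqP; lra.
have nz2 : c - 1 != 0 by apply/eqP; lra.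
have nz3 : c ^+ 2 - 1 != 0 by rewrite subr_sqr_1 mulf_neq0.
have nz4 : 2 * c - 2 != 0 by apply/eqP; lra.
have nz5 : 2 * c + 2 != 0 by apply/eqP; lra.
(* This identity cancels the terms in [ln |y|] when [x = 1 / y] is substituted into [Q m]. *)
have ABC : A + B = C by rewrite /A /B /C; field; rewrite nz3 nz4 nz5.
pose V y : R := A * ln `|1 - y| + B * ln `|1 + y| - C * ln `|c - y|.
pose dV y : R := A * (- 1 / (1 - y)) + B * (1 / (1 + y)) - C * (- 1 / (c - y)).
have V0 : V 0 = - (C * ln c).
  by rewrite /V addr0 !subr0 normr1 ln1 [`|c|]gtr0_norm; lra.
have := @outer_branches R (@Q R m) V dV; rewrite V0; apply.
- move=> x x1.
  have x0 : x != 0 by apply/eqP => e; move: x1; rewrite e normr0; lra.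
  have xp : 1 + x != 0.
    by apply/eqP => e; move: x1; rewrite (_ : x = -1) ?normrN ?normr1; lra.
  have xm : 1 - x != 0.
    by apply/eqP => e; move: x1; rewrite (_ : x = 1) ?normrN ?normr1; lra.
  have xc : 1 - c * x != 0.
    rewrite subr_eq0; apply/eqP => /(congr1 Num.norm).
    by rewrite normr1 normrM [`|c|]gtr0_norm; nra.
  have -> : V x^-1 = A * ln `|(1 - x) / x| + B * ln `|(1 + x) / x|
      - C * ln `|(1 - c * x) / x|.
    rewrite /V; congr (_ * ln _ + _ * ln _ - _ * ln _).
    + by rewrite -normrN; congr `|_|; field.
    + by congr `|_|; field.
    + by rewrite -normrN; congr `|_|; field.
  by rewrite !ln_norm_div // /Q -/c -/A -/B -/C -ABC; ring.
- move=> y; rewrite ltr_norml => hy.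
  have yp : 1 + y != 0 by apply/eqP; lra.
  have ym : 1 - y != 0 by apply/eqP; lra.
  have yc : c - y != 0 by apply/eqP; lra.
  have dp : is_derive y 1 (fun z : R => 1 + z) 1.
    by apply: (is_derive_eq (is_deriveD _ _)); rewrite add0r.
  have dm a : is_derive y 1 (fun z : R => a - z) (- 1).
    by apply: (is_derive_eq (is_deriveB _ _)); rewrite sub0r.
  exact: (is_deriveB (is_deriveD
    (is_deriveZ A (is_derive_ln_norm R (fun z => 1 - z) y _ ym (dm 1)))
    (is_deriveZ B (is_derive_ln_norm R (fun z => 1 + z) y _ yp dp)))
    (is_deriveZ C (is_derive_ln_norm R (fun z => c - z) y _ yc (dm c)))).
- move=> y; rewrite ltr_norml => hy y0.
  have yp : 1 + y != 0 by apply/eqP; lra.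
  have ym : 1 - y != 0 by apply/eqP; lra.
  have yc : c - y != 0 by apply/eqP; lra.
  have -> : y * dV y = - (y ^+ 2 / ((1 - y) * (1 + y) * (c - y))).
    by rewrite /dV /A /B /C; field; rewrite yp ym yc nz3 nz4 nz5.
  rewrite oppr_lt0 divr_gt0 ?exprn_even_gt0 // !mulr_gt0 //; lra.
- move=> M; have M0 := normr_ge0 M.
  (* The factor [A^-1] makes [A * ln (1 - y)] equal to [- (1 + |M|)]; the [1] absorbs the bounded
     term [B * ln (1 + y)]. *)
  have t0 : 0 < A^-1 * (1 + `|M|) by rewrite mulr_gt0 ?invr_gt0; lra.
  have [y y01 [ly _]] := @ln_near_one R _ t0.
  exists y => //; rewrite /V !ger0_norm; try lra.
  have l1 : B * ln (1 + y) <= 1.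
    by have := @le_ln1Dx R y ltac:(lra); nra.
  have l2 : 0 <= C * ln (c - y) by rewrite mulr_ge0 ?ln_ge0; lra.
  rewrite ly mulrN mulrA mulfV ?gt_eqF // mul1r.
  have := ler_norm (- M); rewrite normrN; lra.
- move=> M; have M0 := normr_ge0 M.
  have t0 : 0 < B^-1 * (1 + `|M|) by rewrite mulr_gt0 ?invr_gt0; lra.
  have [y y01 [ly _]] := @ln_near_one R _ t0.
  exists y => //; rewrite /V !opprK !ger0_norm; try lra.
  have l1 : A * ln (1 + y) <= 1.
    by have := @le_ln1Dx R y ltac:(lra); nra.
  have l2 : 0 <= C * ln (c + y) by rewrite mulr_ge0 ?ln_ge0; lra.
  rewrite ly mulrN mulrA mulfV ?gt_eqF // mul1r.
  have := ler_norm (- M); rewrite normrN; lra.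
Qed.

(** * From the profile equation to the four families *)

(** The image of [I] under [g] is an interval avoiding [0], so [g] cannot take values on both sides
    of it. *)
Lemma interval_gt1_or_ltN1 (R : realType) (I : set R) (g : R -> R) :
  is_interval I -> (forall s, I s -> {for s, continuous g}) ->
  (forall s, I s -> 1 < `|g s|) ->
  (forall s, I s -> g s < -1) \/ (forall s, I s -> 1 < g s).
Proof.
move=> itvI cg g1.
have itvg : is_interval (g @` I).
  apply/connected_intervalP/connected_continuous_connected.
    exact/connected_intervalP.
  by apply: continuous_in_subspaceT => s; rewrite inE => /cg.
have [[s [Is gs]]|no] := pselect (exists s, I s /\ g s < -1); last first.
  right=> s Is; have := g1 s Is; rewrite lter_normr => /orP[//|gs].
  by exfalso; apply: no; exists s; split=> //; lra.
left=> t It; have := g1 t It; rewrite lter_normr => /orP[gt|]; last lra.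
have [|x Ix gx0] := itvg (g s) (g t) (imageP g Is) (imageP g It) 0; first lra.
by have := g1 x Ix; rewrite gx0 normr0; lra.
Qed.

Lemma profile_of_ode (R : realType) (m : nat) (I : set R) (f f1 f2 : R -> R) :
  (0 < m)%N -> is_interval I ->
  (forall s, I s -> is_derive s 1 f (f1 s)) ->
  (forall s, I s -> is_derive s 1 f1 (f2 s)) ->
  (forall s, I s -> 1 < `|f1 s|) ->
  (forall s, I s -> f2 s = (1 - m%:R * f1 s) * (1 - f1 s ^+ 2)) ->
  translator_profile m.+1 I f.
Proof.
move=> m0 itvI df df1 f1gt ode; set c : R := m%:R.
have c1 : 1 <= c by rewrite ler1n.
pose w x : R := ((1 - c * x) * (1 - x ^+ 2))^-1.
have nz (x : R) : x < -1 \/ 1 < x ->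
    [/\ 1 - x != 0, 1 + x != 0, 1 - c * x != 0 & 1 - x ^+ 2 != 0].
  by move=> hx; split; apply/eqP => e; case: hx => hx; nra.
have w0 (x : R) : x < -1 \/ 1 < x -> w x != 0.
  by move=> /nz [? ? ? ?]; rewrite invr_eq0 mulf_neq0.
have wf s : I s -> w (f1 s) * f2 s = 1.
  move=> Is; rewrite ode // mulVf // mulf_neq0 //.
    1,2: have := f1gt s Is; rewrite lter_normr => f1s;
      have [] // := nz (f1 s); case/orP: f1s; lra.
have dp (x : R) : is_derive x 1 (fun z : R => 1 + z) 1.
  by apply: (is_derive_eq (is_deriveD _ _)); rewrite add0r.
have dm (x : R) : is_derive x 1 (fun z : R => 1 - z) (- 1).
  by apply: (is_derive_eq (is_deriveB _ _)); rewrite sub0r.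
have dc (x : R) : is_derive x 1 (fun z : R => 1 - c * z) (- c).
  by apply: (is_derive_eq (is_deriveB _ (is_deriveZ c (is_derive_id _ _))));
    rewrite sub0r [_ *: _]mulr1.
have cf1 s : I s -> {for s, continuous f1}.
  by move=> /df1 [+ _] => /derivable1_diffP/differentiable_continuous.
(* For [m = 1] the factor [1 - m x] merges with [1 - x] into a double root, the source of the term
   [(1 - x)^-1] in [P] and of the separate treatment. *)
have [m1|m2] : m = 1%N \/ (1 < m)%N.
  by case: m m0 {c c1 w nz w0 wf dc ode} => [|[|]]; auto.
- have ce : c = 1 by rewrite /c m1.
  have dP : forall x : R, x < -1 \/ 1 < x -> is_derive x 1 (@P R) (w x).
    move=> x /nz [xm xp _ x2].
    have D := is_deriveD (is_deriveD
      (is_deriveZ (- 4^-1) (is_derive_ln_norm R (fun z => 1 - z) x _ xm (dm x)))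
      (is_deriveZ 2^-1 (is_deriveV (f := fun z : R => 1 - z) xm (dm x))))
      (is_deriveZ 4^-1 (is_derive_ln_norm R (fun z => 1 + z) x _ xp (dp x))).
    apply: (@is_derive_eq _ _ _ (@P R) x 1 _ _ D).
    by rewrite /w ce mul1r /GRing.scale /=; field; rewrite xm xp x2.
  (* Partial fractions of [x * w x = x / ((1 - x) ^ 2 * (1 + x))], integrated termwise. *)
  pose G (x : R) : R := 4^-1 * ln `|1 - x| + 2^-1 * (1 - x)^-1 - 4^-1 * ln `|1 + x|.
  have dG : forall x : R, x < -1 \/ 1 < x -> is_derive x 1 G (x * w x).
    move=> x /nz [xm xp _ x2].
    have D := is_deriveB (is_deriveD
      (is_deriveZ 4^-1 (is_derive_ln_norm R (fun z => 1 - z) x _ xm (dm x)))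
      (is_deriveZ 2^-1 (is_deriveV (f := fun z : R => 1 - z) xm (dm x))))
      (is_deriveZ 4^-1 (is_derive_ln_norm R (fun z => 1 + z) x _ xp (dp x))).
    apply: (@is_derive_eq _ _ _ G x 1 _ _ D).
    by rewrite /w ce mul1r /GRing.scale /=; field; rewrite xm xp x2.
  have [[inj1 im1] [inj3 im3]] := P_branches R.
  rewrite m1; have [neg|pos] := interval_gt1_or_ltN1 _ _ _ itvI cf1 f1gt.
  + rewrite /translator_profile; apply: Or41; split; first by []; rewrite /P1_inv.
    have H := @profile_of_relation R `]-oo, (-1)[ I (@P R) G w f f1 f2 0 _ inj1 im1.
    refine (H _ _ _ _ itvI _ df df1 wf); clear H.
    exact: interval_open.
    * by move=> x /=; rewrite in_itv /= => ?; apply: w0; left.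
    * by move=> x /=; rewrite in_itv /= => ?; apply: dP; left.
    * by move=> x /=; rewrite in_itv /= => ?; apply: dG; left.
    * by move=> s /neg; rewrite /= in_itv.
  + rewrite /translator_profile; apply: Or42; split; first by []; rewrite /P3_inv.
    have H := @profile_of_relation R `]1, +oo[ I (@P R) G w f f1 f2 0 _ inj3 im3.
    refine (H _ _ _ _ itvI _ df df1 wf); clear H.
    exact: interval_open.
    * by move=> x /=; rewrite in_itv /= andbT => ?; apply: w0; right.
    * by move=> x /=; rewrite in_itv /= andbT => ?; apply: dP; right.
    * by move=> x /=; rewrite in_itv /= andbT => ?; apply: dG; right.
    * by move=> s /pos; rewrite /= in_itv /= andbT.
have c2 : 2 <= c by rewrite ler_nat.
have nz3 : c ^+ 2 - 1 != 0 by apply/eqP; nra.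
have nz4 : 2 * c - 2 != 0 by apply/eqP; lra.
have nz5 : 2 * c + 2 != 0 by apply/eqP; lra.
have cS : m.+1%:R = c + 1 :> R by rewrite -natr1.
set A : R := (2 * c - 2)^-1; set B := (2 * c + 2)^-1.
have dQ : forall x : R, x < -1 \/ 1 < x -> is_derive x 1 (@Q R m) (w x).
  move=> x /nz [xm xp xc x2].
  have D := is_deriveB (is_deriveD
    (is_deriveZ A (is_derive_ln_norm R (fun z => 1 - z) x _ xm (dm x)))
    (is_deriveZ B (is_derive_ln_norm R (fun z => 1 + z) x _ xp (dp x))))
    (is_deriveZ (c / (c ^+ 2 - 1))
      (is_derive_ln_norm R (fun z => 1 - c * z) x _ xc (dc x))).
  apply: (@is_derive_eq _ _ _ (@Q R m) x 1 _ _ D).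
  by rewrite /w /A /B /GRing.scale /=; field; rewrite xm xp xc nz3 nz4 nz5 x2.
(* Partial fractions again, now with the three simple poles [1], [-1] and [1 / c]. *)
pose G (x : R) : R :=
  A * ln `|1 - x| - B * ln `|1 + x| - (c ^+ 2 - 1)^-1 * ln `|1 - c * x|.
have dG : forall x : R, x < -1 \/ 1 < x -> is_derive x 1 G (x * w x).
  move=> x /nz [xm xp xc x2].
  have D := is_deriveB (is_deriveB
    (is_deriveZ A (is_derive_ln_norm R (fun z => 1 - z) x _ xm (dm x)))
    (is_deriveZ B (is_derive_ln_norm R (fun z => 1 + z) x _ xp (dp x))))
    (is_deriveZ (c ^+ 2 - 1)^-1
      (is_derive_ln_norm R (fun z => 1 - c * z) x _ xc (dc x))).
  apply: (@is_derive_eq _ _ _ G x 1 _ _ D).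
  by rewrite /w /A /B /GRing.scale /=; field; rewrite xm xp xc nz3 nz4 nz5 x2.
have [[inj1 im1] [inj4 im4]] := Q_branches R m _ m2 erefl.
have nz6 : 2 * (c + 1) - (c + 1) ^+ 2 != 0 by apply/eqP; nra.
have [neg|pos] := interval_gt1_or_ltN1 _ _ _ itvI cf1 f1gt.
- rewrite /translator_profile; apply: Or43; split; first by []; rewrite /Q1_inv.
  rewrite /= cS.
  (* With [n = c + 1] one has [n ^ 2 - 2 n = c ^ 2 - 1], so the stated endpoint is the supremum of
     [Q m] on this branch. The endpoint for [Q4_inv] is the same number with numerator and
     denominator negated. *)
  have -> : (1 - (c + 1)) / ((c + 1) ^+ 2 - 2 * (c + 1)) * ln (c + 1 - 1) =
      - (c / (c ^+ 2 - 1) * ln c).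
    by rewrite addrK; field; exact: nz3.
  have H := @profile_of_relation R `]-oo, (-1)[ I (@Q R m) G w f f1 f2 _ _ inj1 im1.
  refine (H _ _ _ _ itvI _ df df1 wf); clear H.
    exact: interval_open.
  + by move=> x /=; rewrite in_itv /= => ?; apply: w0; left.
  + by move=> x /=; rewrite in_itv /= => ?; apply: dQ; left.
  + by move=> x /=; rewrite in_itv /= => ?; apply: dG; left.
  + by move=> s /neg; rewrite /= in_itv.
- rewrite /translator_profile; apply: Or44; split; first by []; rewrite /Q4_inv.
  rewrite /= cS.
  have -> : (c + 1 - 1) / (2 * (c + 1) - (c + 1) ^+ 2) * ln (c + 1 - 1) =
      - (c / (c ^+ 2 - 1) * ln c).
    by rewrite addrK; field; rewrite nz3 nz6.
  have H := @profile_of_relation R `]1, +oo[ I (@Q R m) G w f f1 f2 _ _ inj4 im4.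
  refine (H _ _ _ _ itvI _ df df1 wf); clear H.
    exact: interval_open.
  + by move=> x /=; rewrite in_itv /= andbT => ?; apply: w0; right.
  + by move=> x /=; rewrite in_itv /= andbT => ?; apply: dQ; right.
  + by move=> x /=; rewrite in_itv /= andbT => ?; apply: dG; right.
  + by move=> s /pos; rewrite /= in_itv /= andbT.
Qed.

(** * Partial derivatives as derivatives along lines *)

(** The two difference quotients are the same function of [h], so nothing about [f] beyond the
    direction [v] is involved. *)
Lemma is_derive_along_line (R : realType) (V W : normedModType R) (f : V -> W)
    (p v : V) (x : R) (l : W) :
  is_derive (x *: v + p) v f l <->
  is_derive x 1 (fun z : R => f (z *: v + p)) l.
Proof.
have e :
    (fun h : R =>
      h^-1 *: ((f \o shift (x *: v + p)) (h *: v) - f (x *: v + p))) =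
    (fun h : R => h^-1 *: (((fun z : R => f (z *: v + p)) \o shift x) (h *: 1)
       - f (x *: v + p))).
  by apply/funext => h; rewrite /= [h *: 1]mulr1 scalerDl addrA.
by split=> -[d D]; split; rewrite /derivable /derive ?e // -?e.
Qed.

Lemma is_derive_coordinate (R : realType) (n : nat) (i j : 'I_n) (p : 'rV[R]_n) :
  is_derive p (delta_mx 0 i) (fun x : 'rV[R]_n => x 0 j) (i == j)%:R.
Proof.
rewrite -[p]add0r -[0 in X in is_derive X](scale0r (delta_mx 0 i)).
apply/is_derive_along_line.
have -> : (fun z : R => (z *: (delta_mx 0 i : 'rV[R]_n) + p) 0 j) =
    (i == j)%:R \*: id + cst (p 0 j).
  by apply/funext => z; rewrite !mxE eqxx /= eq_sym /GRing.scale /= mulrC fctE.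
apply: is_derive_eq; by rewrite addr0 [_ *: _]mulr1.
Qed.

Lemma partial_coordinate (R : realType) (n : nat) (i j : 'I_n) (p : 'rV[R]_n) :
  partial i (fun x => x 0 j) p = (i == j)%:R.
Proof. by have [] := is_derive_coordinate R n i j p. Qed.

Lemma partial_cst (R : realType) (n : nat) (i : 'I_n) (a : R) (p : 'rV[R]_n) :
  partial i (fun=> a) p = 0.
Proof. by have [] := is_derive_cst a p (delta_mx 0 i). Qed.

Lemma partial_inv_sqr_coordinate (R : realType) (n : nat) (i j : 'I_n)
    (p : 'rV[R]_n) : p 0 j != 0 ->
  partial i (fun x => x 0 j ^- 2) p = - 2 * p 0 j ^- 3 * (i == j)%:R.
Proof.
move=> pj.
have d := (is_derive_along_line R _ _ (fun x : 'rV[R]_n => x 0 j) p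
  (delta_mx 0 i) 0 _).1 (is_derive_coordinate R n i j _).
set g := fun z : R => _ in d.
have g0 : g 0 = p 0 j by rewrite /g scale0r add0r.
have gX : (g ^+ 2) 0 != 0 by rewrite fctE g0 expf_neq0.
have D := is_deriveV gX (is_deriveX 2 d).
have := (is_derive_along_line R _ _ (fun x : 'rV[R]_n => x 0 j ^- 2) p
  (delta_mx 0 i) 0 _).2 D.
rewrite scale0r add0r /partial => -[_ ->].
by rewrite !fctE g0 /GRing.scale /=; field.
Qed.

(** * The Lorentzian product metric and its Christoffel symbols *)

Lemma invmx_diag_mx (R : realType) (n : nat) (d : 'rV[R]_n) :
  (forall i, d 0 i != 0) -> invmx (diag_mx d) = diag_mx (\row_i (d 0 i)^-1).
Proof.
move=> d0.
have dK : diag_mx d *m diag_mx (\row_i (d 0 i)^-1) = 1%:M.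
  by apply/matrixP => i j; rewrite mul_diag_mx !mxE mulrnAr mulfV.
by rewrite -[RHS]mul1mx -(mulVmx (mulmx1_unit dK).1) -mulmxA dK mulmx1.
Qed.

Lemma lorentz_product_metricE (R : realType) (m : nat) (q : 'rV[R]_(m.+1 + 1)) :
  @lorentz_product_metric R m q =
  diag_mx (row_mx (const_mx (q 0 (lshift 1 0) ^- 2)) (const_mx (-1))).
Proof.
apply/matrixP => a b; rewrite /lorentz_product_metric /hyperbolic_metric.
case: (split_ordP a) => i ->; case: (split_ordP b) => j ->.
- by rewrite block_mxEul [RHS]mxE row_mxEl !mxE eq_lshift.
- by rewrite block_mxEur [RHS]mxE eq_lrshift mxE.
- by rewrite block_mxEdl [RHS]mxE eq_rlshift mxE.
- by rewrite block_mxEdr [RHS]mxE row_mxEr !mxE eq_rshift mulNrn.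
Qed.

Lemma inv_lorentz_product_metric (R : realType) (m : nat)
    (q : 'rV[R]_(m.+1 + 1)) : q 0 (lshift 1 0) != 0 ->
  invmx (@lorentz_product_metric R m q) =
  diag_mx (row_mx (const_mx (q 0 (lshift 1 0) ^+ 2)) (const_mx (-1))).
Proof.
move=> q0; rewrite lorentz_product_metricE invmx_diag_mx.
  congr diag_mx; apply/rowP => a.
  by case: (split_ordP a) => i ->;
    rewrite mxE ?row_mxEl ?row_mxEr !mxE ?invrK ?invrN1.
move=> a; case: (split_ordP a) => i ->;
  by rewrite ?row_mxEl ?row_mxEr mxE ?invr_eq0 ?expf_neq0 ?oppr_eq0 ?oner_eq0.
Qed.

Lemma partial_lorentz_product_metric (R : realType) (m : nat)
    (q : 'rV[R]_(m.+1 + 1)) (a b c : 'I_(m.+1 + 1)) : q 0 (lshift 1 0) != 0 ->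
  partial c (fun x => @lorentz_product_metric R m x a b) q =
  - 2 * q 0 (lshift 1 0) ^- 3 * [&& a == b, (a < m.+1)%N & c == lshift 1 0]%:R.
Proof.
move=> q0; have [<-{b}|ab] := eqVneq a b; last first.
  rewrite mulr0 -(partial_cst R _ c 0 q); congr partial; apply/funext => x.
  by rewrite lorentz_product_metricE mxE (negbTE ab).
have e x : @lorentz_product_metric R m x a a =
    (row_mx (const_mx (x 0 (lshift 1 0) ^- 2)) (const_mx (-1)) : 'rV[R]__) 0 a.
  by rewrite lorentz_product_metricE [LHS]mxE eqxx mulr1n.
under eq_fun do rewrite e.
case: (split_ordP a) => i ->.
  under eq_fun do rewrite row_mxEl mxE.
  by rewrite partial_inv_sqr_coordinate // eqxx (ltn_ord i).
under eq_fun do rewrite row_mxEr mxE.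
by rewrite partial_cst /= mulr0.
Qed.

(** The conormal has only an [x_1] and a [t] component, so pairing with it calls for the symbols
    with these two upper indices. As the inverse metric is diagonal, the sum over [l] reduces to the
    upper index itself. *)
Lemma christoffel_lorentz_0 (R : realType) (m : nat) (q : 'rV[R]_(m.+1 + 1))
    (b c : 'I_(m.+1 + 1)) : q 0 (lshift 1 0) != 0 ->
  christoffel (@lorentz_product_metric R m) q (lshift 1 0) b c =
  (q 0 (lshift 1 0))^-1 *
    (((b == c) && (b < m.+1)%N)%:R
     - 2 * (b == lshift 1 0)%:R * (c == lshift 1 0)%:R).
Proof.
move=> q0; rewrite /christoffel inv_lorentz_product_metric //.
rewrite (bigD1 (lshift 1 0)) //= big1 ?addr0; last first.
  by move=> l l0; rewrite !mxE eq_sym (negbTE l0) mul0r.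
rewrite !partial_lorentz_product_metric // mxE !eqxx row_mxEl mxE mulr1n andbT.
have ltb (d e : 'I_(m.+1 + 1)) :
    [&& d == lshift 1 0, (d < m.+1)%N & e == lshift 1 0] =
   (d == lshift 1 0) && (e == lshift 1 0).
  by case: eqP => // ->.
rewrite !ltb -!mulnb !natrM; field.
exact: q0.
Qed.

(** The [t] row of the metric is constant, and no entry of the metric varies with [t]. *)
Lemma christoffel_lorentz_t (R : realType) (m : nat) (q : 'rV[R]_(m.+1 + 1))
    (b c : 'I_(m.+1 + 1)) : q 0 (lshift 1 0) != 0 ->
  christoffel (@lorentz_product_metric R m) q (rshift m.+1 0) b c = 0.
Proof.
move=> q0; rewrite /christoffel inv_lorentz_product_metric //.
rewrite (bigD1 (rshift m.+1 0)) //= big1 ?addr0; last first.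
  by move=> l l0; rewrite !mxE eq_sym (negbTE l0) mul0r.
rewrite !partial_lorentz_product_metric //= eq_rlshift andbF.
have ltb (d : 'I_(m.+1 + 1)) : (d == rshift m.+1 0) && (d < m.+1)%N = false.
  by case: eqP => // ->; rewrite /= ltnNge leq_addr.
have ltb' (d e : 'I_(m.+1 + 1)) :
    [&& d == rshift m.+1 0, (d < m.+1)%N & e == lshift 1 0] = false.
  by rewrite andbA ltb.
by rewrite !ltb' andbF !mulr0 addr0 subrr !mulr0.
Qed.

Lemma sum_delta (R : pzRingType) (n : nat) (d : 'I_n) (g : 'I_n -> R) :
  \sum_(c < n) (c == d)%:R * g c = g d.
Proof.
rewrite (bigD1 d) //= eqxx mul1r big1 ?addr0 // => c /negbTE ->.
by rewrite mul0r.
Qed.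

Lemma tangent_graph_map (R : realType) (m : nat) (u : 'rV[R]_m.+1 -> R)
    (i : 'I_m.+1) (p : 'rV[R]_m.+1) :
  tangent (graph_map u) i p = row_mx (delta_mx 0 i) (partial i u p)%:M.
Proof.
apply/rowP => a; case: (split_ordP a) => j ->.
  rewrite mxE row_mxEl mxE eqxx /=.
  under eq_fun do rewrite row_mxEl.
  by rewrite partial_coordinate eq_sym.
rewrite mxE row_mxEr mxE ord1 eqxx mulr1n.
by under eq_fun do rewrite row_mxEr mxE eqxx mulr1n.
Qed.

(** * The translator equation at a point where [u] varies only with [x_1] *)

Section Translator.
Variables (R : realType) (m : nat) (u : 'rV[R]_m.+1 -> R) (p : 'rV[R]_m.+1).
Let G := @lorentz_product_metric R m.
Let F := graph_map u.
Let x : R := p 0 0.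
Let a := partial 0 u p.
Let b := partial 0 (partial 0 u) p.
Hypothesis x0 : x != 0.
(** The gradient has squared norm [x ^ 2 * a ^ 2], so this says that its norm is not [1]: the entry
    of the induced metric in direction [x_1] does not vanish. *)
Hypothesis timelike : x ^- 2 - a ^+ 2 != 0.
Hypothesis du0 : forall i : 'I_m.+1, i != 0 -> partial i u p = 0.
Hypothesis ddu0 : forall i : 'I_m.+1, i != 0 -> partial i (partial i u) p = 0.

Let partialE i : partial i u p = (i == 0)%:R * a.
Proof. by case: eqVneq => [->|/du0 ->]; rewrite ?mul1r ?mul0r. Qed.

(** A covector, stored as a column so that its pairing with a row vector [v] is [v *m normal],
    without using the metric. *)
Let normal : 'cV[R]_(m.+1 + 1) := col_mx (a *: delta_mx 0 0) (- 1%:M).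

Let tangent_normal i : tangent F i p *m normal = 0.
Proof.
rewrite tangent_graph_map mul_row_col -scalemxAr mul_delta_mx_cond partialE.
apply/matrixP => r c; rewrite !ord1 !mxE big_ord1 !mxE !eqxx /=.
by case: (i == 0); rewrite ?mulr1n ?mulr0n !mxE /=; ring.
Qed.

(** The tangential projection is a combination of tangent vectors, each of which pairs to zero
    whatever its coefficient. *)
Let normal_part_normal v : normal_part G F p v *m normal = v *m normal.
Proof.
rewrite /normal_part mulmxBl mulmx_suml big1 ?subr0 // => i _.
rewrite mulmx_suml big1 // => j _.
by rewrite -scalemxAl tangent_normal scaler0.
Qed.

Let Fx : F p 0 (lshift 1 0) = x.
Proof. by rewrite /F /graph_map row_mxEl. Qed.

Let induced_metricE :
  induced_metric G F p = diag_mx (\row_i (x ^- 2 - (i == 0)%:R * a ^+ 2)).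
Proof.
apply/matrixP => i j; rewrite mxE /inner.
rewrite !tangent_graph_map /G /lorentz_product_metric /hyperbolic_metric.
rewrite /F /graph_map row_mxKl mul_row_block !mulmx0 addr0 add0r tr_row_mx.
rewrite mul_row_col mul_mx_scalar trmx_delta -scalemxAl mul_delta_mx_cond.
rewrite tr_scalar_mx !partialE !mxE big_ord1 !mxE big_ord1 !mxE /= !mulr1n -/x.
case: (eqVneq i j) => [<-|ij]; rewrite /= ?mulr1n ?mulr0n.
  by rewrite mxE !eqxx /=; case: (i == 0); rewrite /=; ring.
rewrite mxE mulr0 add0r; case: (eqVneq i 0) => [i0|_]; last by rewrite !mul0r.
by move: ij; rewrite i0 eq_sym => /negbTE ->; rewrite !(mul0r, mulr0).
Qed.

Let inv_induced_metric :
  invmx (induced_metric G F p) =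
  diag_mx (\row_i (x ^- 2 - (i == 0)%:R * a ^+ 2)^-1).
Proof.
rewrite induced_metricE invmx_diag_mx.
  by congr diag_mx; apply/rowP => i; rewrite !mxE.
move=> i; rewrite mxE; case: (i == 0); first by rewrite mul1r.
by rewrite mul0r subr0 invr_eq0 expf_neq0.
Qed.

(** The inverse induced metric is diagonal, so the terms [i = j] are those entering the mean
    curvature. The first summand is [a] times a Christoffel symbol with upper index [x_1]; the
    second comes from the [t] component, whose Christoffel symbols vanish. *)
Let cov_deriv_normal i :
  (cov_deriv G F i i p *m normal) 0 0 =
  x^-1 * (1 - 2 * (i == 0)%:R) * a - partial i (partial i u) p.
Proof.
rewrite mxE big_split_ord /= big_ord1 (bigD1 0) //= big1 ?addr0; last first.
  by move=> j j0; rewrite col_mxEu !mxE (negbTE j0) /= !mulr0.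
rewrite col_mxEu col_mxEd !mxE !eqxx /= !mulr1 mulrN mulr1.
congr (_ * _ - _).
  under eq_fun do rewrite tangent_graph_map row_mxEl mxE eqxx /=.
  rewrite partial_cst add0r; set T := fun b => tangent F i p 0 b.
  have T0 j : T (lshift 1 j) = (j == i)%:R.
    by rewrite /T tangent_graph_map row_mxEl mxE eqxx.
  have inner_sum d : \sum_(c < m.+1 + 1)
      christoffel G (F p) (lshift 1 0) d c * T d * T c =
      x^-1 * ((d < m.+1)%:R * (T d * T d)
        - 2 * (d == lshift 1 0)%:R * T d * T (lshift 1 0)).
    rewrite (eq_bigr (fun c => x^-1 * (d < m.+1)%:R * T d * ((c == d)%:R * T c)
      - 2 * x^-1 * (d == lshift 1 0)%:R * T d * ((c == lshift 1 0)%:R * T c))).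
      by rewrite sumrB -!mulr_sumr !sum_delta; ring.
    move=> c _.
    by rewrite christoffel_lorentz_0 Fx // -mulnb natrM [d == c]eq_sym; ring.
  under eq_bigr do rewrite inner_sum.
  rewrite -mulr_sumr big_split_ord big_ord1.
  (* The index [d = t] contributes nothing: both indicators in [inner_sum] vanish for it. *)
  have -> : (rshift m.+1 (ord0 : 'I_1) < m.+1)%N = false by rewrite ltnNge leq_addr.
  rewrite eq_rlshift mul0r mulr0 !mul0r subr0 [X in _ * X]addr0; congr (_ * _).
  rewrite (eq_bigr (fun j => (j == i)%:R * 1 - 2 * ((j == i)%:R * (i == 0)%:R))).
    by rewrite sumrB -mulr_sumr !sum_delta.
  move=> j _; rewrite !T0 (ltn_ord j) eq_lshift [0 == i]eq_sym.
  by case: (eqVneq j i) => [->|_]; case: (i == 0); rewrite /=; ring.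
have -> : \sum_(d < m.+1 + 1) \sum_(c < m.+1 + 1)
   christoffel G (F p) (rshift m.+1 0) d c * tangent F i p 0 d *
   tangent F i p 0 c = 0.
  rewrite big1 // => d _; rewrite big1 // => c _.
  by rewrite christoffel_lorentz_t ?Fx // !mul0r.
rewrite addr0; congr partial; apply/funext => y.
by rewrite tangent_graph_map row_mxEr mxE eqxx mulr1n.
Qed.

(** In the trace paired with the conormal, direction [x_1] gives the quotient and each of the other
    [m] directions gives [x ^ 2 * (x^-1 * a) = x * a], while [partial_t] pairs to [-1]. *)
Lemma translator_equation :
  mean_curvature_vector G F p = normal_part G F p (partial_t R m) ->
  - (x^-1 * a + b) / (x ^- 2 - a ^+ 2) + m%:R * (x * a) = -1.
Proof.
move=> /(congr1 (fun v => (v *m normal) 0 0)).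
rewrite normal_part_normal /partial_t mul_row_col mul0mx add0r mulmxN mulmx1.
have -> : (- 1%:M : 'M[R]_1) 0 0 = -1 by rewrite !mxE.
move=> <-.
rewrite /mean_curvature_vector inv_induced_metric mulmx_suml summxE.
under eq_bigr => i _.
  rewrite (bigD1 i) //= big1 ?addr0; last first.
    by move=> j ji; rewrite !mxE [i == j]eq_sym (negbTE ji) scale0r.
  rewrite -scalemxAl normal_part_normal mxE cov_deriv_normal !mxE eqxx mulr1n.
  over.
rewrite big_ord_recl /= mul1r -/b.
rewrite [in RHS](eq_bigr (fun=> x * a)); last first.
  move=> i _; rewrite ddu0 //= !(mul0r, mulr0, subr0) mulr1.
  by field.
have nz : 1 + - a ^+ 2 * x ^+ 2 != 0.
  rewrite (_ : _ + _ = x ^+ 2 * (x ^- 2 - a ^+ 2)); last by field.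
  by rewrite mulf_neq0 ?expf_neq0.
rewrite sumr_const card_ord mulr_natl; congr (_ + _).
by field; rewrite x0 nz.
Qed.

End Translator.

(** * Passage between [Omega] and functions of one variable *)

Lemma derive_cst_line (R : realType) (V W : normedModType R) (f : V -> W)
    (p v : V) :
  (forall z : R, f (z *: v + p) = f p) -> 'D_v f p = 0.
Proof.
move=> fE; have d : is_derive (0 : R) 1 (fun z : R => f (z *: v + p)) 0.
  have -> : (fun z : R => f (z *: v + p)) = cst (f p) by apply/funext => z /=.
  exact: is_derive_cst.
have := (is_derive_along_line R V W f p v 0 0).2 d.
by rewrite scale0r add0r => -[].
Qed.

Lemma near_eq_continuous (T U : topologicalType) (f g : T -> U) (x : T) :
  (\near x, f x = g x) -> {for x, continuous g} -> {for x, continuous f}.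
Proof.
move=> fg cg; have fgx : f x = g x by exact: nbhs_singleton fg.
rewrite /prop_for /continuous_at fgx; apply: cvg_trans cg.
by apply: near_eq_cvg; near=> y; apply/esym; near: y.
Unshelve. all: by end_near. Qed.

(** The functions [derive1 f] and [f1] are known to agree only on [I]; openness of [I] turns this
    into agreement near each point, which is what continuity and derivability require. *)
Lemma C2_on_line_of_derivatives (R : realType) (I : set R) (f f1 f2 : R -> R) :
  open I ->
  (forall s, I s -> is_derive s 1 f (f1 s)) ->
  (forall s, I s -> is_derive s 1 f1 (f2 s)) ->
  (forall s, I s -> {for s, continuous f2}) ->
  C2_on_line I f.
Proof.
move=> oI df df1 cf2.
have nI s : I s -> \near s, I s by move=> Is; apply: open_nbhs_nbhs.
have e1 s : I s -> derive1 f s = f1 s.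
  by move=> /df [_ <-]; rewrite derive1E.
have ne1 s : I s -> \near s, f1 s = derive1 f s.
  by move=> /nI; apply: filterS => t /e1.
have e2 s : I s -> derive1n 2 f s = f2 s.
  move=> Is; rewrite derive1nS /= derive1E -(near_eq_derive _ (ne1 s Is)).
  by have [_ ->] := df1 s Is.
move=> s Is; split.
- by have [d _] := df s Is; exact/differentiable_continuous/derivable1_diffP.
- by have [] := df s Is.
- apply: (@near_eq_continuous _ _ _ f1); first by near do apply: e1; exact: nI.
  by have [d _] := df1 s Is; exact/differentiable_continuous/derivable1_diffP.
- by apply: near_eq_derivable (ne1 s Is) _; have [] := df1 s Is.
- apply: (@near_eq_continuous _ _ _ f2); last exact: cf2.
  by near do apply: e2; exact: nI.
Unshelve. all: by end_near. Qed.

(** Raising the index multiplies [a] by [x ^ 2], so the squared norm is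
    [x^-2 * (x ^ 2 * a) ^ 2 = (x * a) ^ 2]. *)
Lemma riem_norm_gradient (R : realType) (m : nat) (u : 'rV[R]_m.+1 -> R)
    (p : 'rV[R]_m.+1) :
  p 0 0 != 0 -> (forall i, i != 0 -> partial i u p = 0) ->
  riem_norm (@hyperbolic_metric R m) p (gradient (@hyperbolic_metric R m) u p) =
  `|p 0 0 * partial 0 u p|.
Proof.
move=> p0 du0; set x := p 0 0; set a := partial 0 u p.
have -> : gradient (@hyperbolic_metric R m) u p = (x ^+ 2 * a) *: delta_mx 0 0.
  apply/rowP => i; rewrite !mxE /hyperbolic_metric invmx_scalar invrK eqxx /=.
  rewrite (bigD1 i) //= big1 ?addr0; last first.
    by move=> j ji; rewrite mxE eq_sym (negbTE ji) mul0r.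
  rewrite mxE eqxx mulr1n; case: (eqVneq i 0) => [->|i0]; first by rewrite mulr1.
  by rewrite du0 // !mulr0.
rewrite /riem_norm /inner /hyperbolic_metric -sqrtr_sqr; congr Num.sqrt.
rewrite mul_mx_scalar -scalemxAl mxE linearZ /= trmx_delta -scalemxAl -scalemxAr.
rewrite mul_delta_mx !mxE !eqxx /= -/x; field; exact: p0.
Qed.

(** A transversal to the foliation: it meets each horosphere exactly once, so a function constant on
    horospheres is determined by its values there. *)
Definition axis (R : realType) (m : nat) (x : R) : 'rV[R]_m.+1 :=
  x *: delta_mx 0 0.

Lemma axis0 (R : realType) (m : nat) (x : R) : axis R m x 0 0 = x.
Proof. by rewrite /axis !mxE !eqxx mulr1. Qed.

Lemma continuous_axis (R : realType) (m : nat) : continuous (axis R m).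
Proof. by move=> x; apply: (@scalel_continuous _ _ (delta_mx 0 0)). Qed.

Lemma is_derive_axis (R : realType) (m : nat) (g : 'rV[R]_m.+1 -> R) (x : R) :
  derivable g (axis R m x) (delta_mx 0 0) ->
  is_derive x 1 (g \o axis R m) (partial 0 g (axis R m x)).
Proof.
move=> dg; have := (is_derive_along_line R _ _ g 0 (delta_mx 0 0) x
  (partial 0 g (axis R m x))).1.
rewrite addr0 => /(_ (DeriveDef dg erefl)).
by congr is_derive; apply/funext => z; rewrite /= addr0.
Qed.

(** Moving in a direction other than [x_1] stays on the horosphere, and saturation keeps the whole
    line in [Omega]. Hence [u] is constant along the line; so is its partial derivative, which
    vanishes on all of [Omega]. *)
Lemma foliated_partial_eq0 (R : realType) (m : nat) (Omega : set 'rV[R]_m.+1)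
    (u : 'rV[R]_m.+1 -> R) :
  Omega `<=` @half_space R m -> foliated_by_horospheres Omega u ->
  forall p (i : 'I_m.+1), Omega p -> i != 0 ->
  partial i u p = 0 /\ partial i (partial i u) p = 0.
Proof.
move=> hsub [sat cst] p i Op i0.
have fst (q : 'rV[R]_m.+1) z : (z *: delta_mx 0 i + q) 0 0 = q 0 0.
  by rewrite !mxE eqxx eq_sym (negbTE i0) mulr0 add0r.
have trans q z : Omega q -> horosphere (q 0 0) (z *: delta_mx 0 i + q).
  by move=> Oq; split; rewrite /half_space /= fst //; exact: hsub.
have du q : Omega q -> partial i u q = 0.
  move=> Oq; apply: derive_cst_line => z; apply: (cst (q 0 0)).
  - by split; [apply: (sat q Oq); exact: trans|exact: trans].
  - by split=> //; split=> //; exact: hsub.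
split; first exact: du.
apply: derive_cst_line => z; rewrite !du //.
by apply: (sat p Op); exact: trans.
Qed.

Theorem theorem3p2 (R : realType) (m : nat) (hn : (2 <= m.+1)%N)
    (Omega : set 'rV[R]_m.+1) (u : 'rV[R]_m.+1 -> R)
    (hsub : Omega `<=` @half_space R m)
    (hopen : open Omega) (hconn : connected Omega)
    (hC2 : C2_on Omega u)
    (htime : time_like_graph Omega u)
    (htrans : graphical_translator Omega u) :
  foliated_by_horospheres Omega u <->
  exists (I : set R) (f : R -> R),
    [/\ is_interval I,
        Omega = [set p | half_space p /\ I (rho p)],
        C2_on_line I f,
        (forall p, Omega p -> u p = f (rho p)) &
        translator_profile m.+1 I f].
Proof.
split; last first.
  (* Since [rho] sees only the first coordinate, the description of [Omega] gives saturation and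
     [u = f \o rho] gives constancy on horospheres. *)
  move=> [I [f [_ OmegaE _ uE _]]]; split.
    move=> p Op q [hq qp]; move: Op; rewrite OmegaE /= /rho => -[_ Ip].
    by split=> //; rewrite qp.
  move=> c p q [Op [_ pc]] [Oq [_ qc]].
  by rewrite !uE // /rho pc qc.
move=> hfol; have [sat cst] := hfol.
have du := foliated_partial_eq0 R m Omega u hsub hfol.
(* The map [E] inverts [rho] along the axis: as [rho] is [- ln], level [s] is reached at first
   coordinate [expR (- s)]. *)
pose ax := axis R m; pose E (s : R) := expR (- s).
pose I : set R := [set s | Omega (ax (E s))].
have OE p : Omega p <-> half_space p /\ I (rho p).
  have EK : half_space p -> E (rho p) = p 0 0.
    by move=> hp; rewrite /E /rho opprK lnK.
  split=> [Op|[hp]].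
    split; first exact: hsub.
    rewrite /I /= EK; last exact: hsub.
    by apply: (sat p Op); split; rewrite /half_space /= axis0 //; exact: hsub.
  rewrite /I /= EK // => Oa; apply: (sat _ Oa).
  by split; rewrite // axis0.
have OmegaE : Omega = [set p | half_space p /\ I (rho p)].
  by apply/seteqP; split=> p /OE.
have rhoE s : rho (ax (E s)) = s by rewrite /rho axis0 /E expRK opprK.
have cE : continuous E.
  move=> s; apply: continuous_comp; first exact: opp_continuous.
  exact: continuous_expR.
have oI : open I.
  apply: (@open_comp _ _ (ax \o E)) => // s _.
  by apply: continuous_comp; [exact: cE|exact: continuous_axis].
(* Connectedness of [Omega] enters here, [I] being also its image under [rho], which is continuous
   on [Omega]. *)
have itvI : is_interval I.
  have -> : I = @rho R m @` Omega.
    apply/seteqP; split=> [s Is|_ [p /OE[_ Ip] <-]] //.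
    by exists (ax (E s)).
  apply/connected_intervalP/connected_continuous_connected => //.
  apply: continuous_in_subspaceT => p; rewrite inE => /hsub hp.
  apply: (@continuous_comp _ _ _ (fun p : 'rV[R]_m.+1 => ln (p 0 0)) -%R);
    last exact: opp_continuous.
  apply: (@continuous_comp _ _ _ (fun p : 'rV[R]_m.+1 => p 0 0) (@ln R));
    first exact: coord_continuous.
  exact: continuous_ln.
pose A := partial 0 u; pose B := partial 0 A.
pose f s := u (ax (E s)).
(* The chain rule along the axis with [E' = - E]; the first-order term of [f2] comes from
   differentiating the factor [E]. *)
pose f1 s := - (E s * A (ax (E s))).
pose f2 s := E s * A (ax (E s)) + E s ^+ 2 * B (ax (E s)).
have dE (s : R) : is_derive s 1 E (- E s).
  rewrite -mulrN1.
  exact: (is_derive1_comp (is_derive_expR _) (is_deriveNid _ _)).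
have E0 (s : R) : 0 < E s by exact: expR_gt0.
have dA (s : R) : I s -> is_derive s 1 (A \o ax \o E) (B (ax (E s)) * - E s).
  move=> /hC2 [_ /(_ 0) [_ _ /(_ 0) [d _]]].
  exact: (is_derive1_comp (is_derive_axis _ _ _ _ d) (dE s)).
have df (s : R) : I s -> is_derive s 1 f (f1 s).
  move=> /hC2 [_ /(_ 0) [d _ _]].
  apply: (is_derive_eq (is_derive1_comp (is_derive_axis _ _ _ _ d) (dE s))).
  by rewrite /f1 mulrN mulrC.
have df1 (s : R) : I s -> is_derive s 1 f1 (f2 s).
  move=> Is; have D := is_deriveN (is_deriveM (dE s) (dA s Is)).
  apply: (@is_derive_eq _ _ _ f1 s 1 _ _ D).
  by rewrite /f2 /GRing.scale /=; ring.
have nz (s : R) : E s != 0 by rewrite gt_eqF.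
have f1gt (s : R) : I s -> 1 < `|f1 s|.
  move=> Is; have := htime _ Is; rewrite riem_norm_gradient ?axis0 //.
    by rewrite /f1 normrN.
  by move=> i i0; have [] := du _ i Is i0.
have ode (s : R) : I s -> f2 s = (1 - m%:R * f1 s) * (1 - f1 s ^+ 2).
  move=> Is; have gt := f1gt s Is.
  have nz1 : 1 - f1 s ^+ 2 != 0.
    by rewrite subr_eq0 eq_sym sqrf_eq1 -eqr_norm2 normr1 gt_eqF.
  have nz2 : E s ^- 2 - A (ax (E s)) ^+ 2 != 0.
    rewrite (_ : _ - _ = E s ^- 2 * (1 - f1 s ^+ 2)); last by rewrite /f1; field.
    by rewrite mulf_neq0 ?invr_eq0 ?expf_neq0.
  have := translator_equation R m u (ax (E s)); rewrite !axis0.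
  move=> /(_ (nz s) nz2 (fun i i0 => (du _ i Is i0).1)
    (fun i i0 => (du _ i Is i0).2) (htrans _ Is)).
  (* The factor [1 - f1 s ^+ 2] is [E s ^+ 2] times the denominator, so multiplying by it turns the
     translator equation into the profile equation. *)
  rewrite -/A -/B => /(congr1 (fun z => z * (1 - f1 s ^+ 2))).
  have -> : (- ((E s)^-1 * A (ax (E s)) + B (ax (E s)))
      / (E s ^- 2 - A (ax (E s)) ^+ 2)
      + m%:R * (E s * A (ax (E s)))) * (1 - f1 s ^+ 2) =
      - f2 s - m%:R * f1 s * (1 - f1 s ^+ 2).
    have -> : 1 - f1 s ^+ 2 = E s ^+ 2 * (E s ^- 2 - A (ax (E s)) ^+ 2).
      by rewrite /f1; field.
    by rewrite mulrDl [in LHS]mulrCA mulfVK // /f2 /f1; field.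
  by move=> h; lra.
exists I, f; split => //.
- apply: (@C2_on_line_of_derivatives R I f f1 f2) => // s Is.
  have cA : {for s, continuous (A \o ax \o E)}.
    by have [d _] := dA s Is; exact/differentiable_continuous/derivable1_diffP.
  have cB : {for s, continuous (B \o ax \o E)}.
    apply: continuous_comp; first exact: cE.
    apply: continuous_comp; first exact: continuous_axis.
    by have [_ /(_ 0) [_ _ /(_ 0) []]] := hC2 _ Is.
  apply: continuousD; first by apply: continuousM => //; exact: cE.
  apply: continuousM => //; apply: (@continuous_comp _ _ _ E (fun x => x ^+ 2)).
    exact: cE.
  exact: exprn_continuous.
(* The point [p] and the axis point with the same first coordinate lie on one horosphere, which is
   inside [Omega] by saturation. *)
- move=> p /[dup] /hsub hp Op; apply: (cst (p 0 0)); first by split.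
  have -> : E (rho p) = p 0 0 by rewrite /E /rho opprK lnK.
  have h : horosphere (p 0 0) (ax (p 0 0)) by split; rewrite /half_space /= axis0.
  by split=> //; exact: (sat p Op).
- exact: (@profile_of_ode R m I f f1 f2).
Qed.
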